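(* Let $Y$ be a nonempty closed subset of $\mathbb{R}^m$, let $\bar x\in\mathbb{R}^n$, let $\Omega\subseteq\mathbb{R}^n$ be a convex neighborhood of $\bar x$, and let $O_Y\subseteq\mathbb{R}^m$ be an open set containing $Y$. Let $g$ be a real-valued function defined on $(\mathbb{R}^n\times Y)\cup(\Omega\times O_Y)$ such that $g$ on $\mathbb{R}^n\times Y$ is level-bounded in $y$ locally uniformly in $x$, $g$ is Lipschitz continuous on $\Omega\times O_Y$, and for some $\rho>0$, $g(\cdot,y)$ is $\rho$-weakly concave on $\Omega$ for every $y\in O_Y$. Let $v(x)=\min_{y\in Y}g(x,y)$ and $S(x)=\operatorname{arg\,min}_{y\in Y}g(x,y)$ for $x\in\Omega$. Then $v$ is weakly concave on $\Omega$ and $$\partial v(\bar x)=\mathrm{co}\{\xi\in\mathbb{R}^n:\ \xi\in\partial_xg(\bar x,\bar y)\ \text{and}\ \bar y\in S(\bar x)\}.$$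
   Context: Level-boundedness: $g$ is level-bounded in $y$ locally uniformly in $x$ (on $\mathbb{R}^n\times Y$) if for each $x'\in\mathbb{R}^n$ and $M\in\mathbb{R}$ there is an open ball $B$ around $x'$ such that $\{(x,y)\in B\times Y:g(x,y)\le M\}$ is bounded. Weak concavity: for a convex set $\Omega$ and $\rho>0$, $h$ is $\rho$-weakly convex on $\Omega$ if $h+\frac{\rho}{2}\|\cdot\|^2$ is convex on $\Omega$; $h$ is $\rho$-weakly concave on $\Omega$ if $-h$ is $\rho$-weakly convex on $\Omega$; $h$ is weakly concave if it is $\rho$-weakly concave for some $\rho>0$. For a function $\phi$ Lipschitz on an open set $O\subseteq\mathbb{R}^n$ and $\bar x\in O$, $\partial\phi(\bar x)=\{\xi:\phi^\circ(\bar x;d)\ge\langle\xi,d\rangle\ \forall d\}$ is the Clarke generalized gradient, where $\phi^\circ(\bar x;d)=\limsup_{x\to\bar x,\,t\searrow0}\frac{\phi(x+td)-\phi(x)}{t}$. $\partial_xg(\bar x,\bar y)$ denotes the Clarke generalized gradient of $g(\cdot,\bar y)$ at $\bar x$. $\mathrm{co}$ denotes convex hull. *)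

(* Defs.v *)
From HB Require Import structures.
From mathcomp Require Import all_boot all_order all_algebra.
From mathcomp Require Import all_classical all_reals all_analysis.
Set Implicit Arguments.
Unset Strict Implicit.
Unset Printing Implicit Defensive.
Import Order.TTheory GRing.Theory Num.Theory.
Import numFieldNormedType.Exports.
Local Open Scope classical_set_scope.
Local Open Scope ring_scope.

(* The library norm on 'rV[R]_n is the sup norm. It is used below only where
   the choice of norm is immaterial (balls, boundedness, Lipschitz continuity);
   the Euclidean structure of R^n is given by dot and sqnorm. *)

Definition dot (R : realType) (n : nat) (u v : 'rV[R]_n) : R :=
  \sum_(i < n) u ord0 i * v ord0 i.

Definition sqnorm (R : realType) (n : nat) (u : 'rV[R]_n) : R := dot u u.

Definition rho_weakly_convex (R : realType) (n : nat) (rho : R)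
    (Om : set 'rV[R]_n) (h : 'rV[R]_n -> R) : Prop :=
  convex_function Om (fun x => h x + rho / 2 * sqnorm x).

Definition rho_weakly_concave (R : realType) (n : nat) (rho : R)
    (Om : set 'rV[R]_n) (h : 'rV[R]_n -> R) : Prop :=
  rho_weakly_convex rho Om (fun x => - h x).

Definition weakly_concave (R : realType) (n : nat)
    (Om : set 'rV[R]_n) (h : 'rV[R]_n -> R) : Prop :=
  exists2 rho : R, 0 < rho & rho_weakly_concave rho Om h.

Definition level_bounded_locally_uniformly (R : realType) (n m : nat)
    (Y : set 'rV[R]_m) (g : 'rV[R]_n -> 'rV[R]_m -> R) : Prop :=
  forall (x' : 'rV[R]_n) (M : R), exists2 r : R, 0 < r &
    bounded_set [set p : 'rV[R]_n * 'rV[R]_m |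
      (ball x' r `*` Y) p /\ g p.1 p.2 <= M].

(* The limsup over x -> xbar and t decreasing to 0, with values in \bar R; it is
   finite as soon as phi is Lipschitz near xbar. *)
Definition clarke_deriv (R : realType) (n : nat) (phi : 'rV[R]_n -> R)
    (xbar d : 'rV[R]_n) : \bar R :=
  limf_esup
    (fun p : 'rV[R]_n * R => ((phi (p.1 + p.2 *: d) - phi p.1) / p.2)%:E)
    (filter_prod (nbhs xbar) (at_right (0 : R))).

Definition clarke_gradient (R : realType) (n : nat) (phi : 'rV[R]_n -> R)
    (xbar : 'rV[R]_n) : set 'rV[R]_n :=
  [set xi | forall d, ((dot xi d)%:E <= clarke_deriv phi xbar d)%E].

Definition convex_hull (R : realType) (n : nat) (A : set 'rV[R]_n) :
    set 'rV[R]_n :=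
  smallest (@convex_set R 'rV[R]_n) A.

Definition argmin (R : realType) (T : Type) (Y : set T) (f : T -> R) : set T :=
  [set y | Y y /\ forall z, Y z -> f y <= f z].

(* The minimum whenever argmin Y f is nonempty. *)
Definition min_value (R : realType) (T : Type) (Y : set T) (f : T -> R) : R :=
  inf (f @` Y).

(* Main.v *)
(* Near xbar a Lipschitz rho-weakly concave function f has as Clarke gradient the
   set of its proximal supergradients, i.e. the xi such that
     f x <= f xbar + <xi, x - xbar> + rho/2 |x - xbar|^2   for x near xbar.
   In this form the inclusion of the convex hull in the gradient of v is
   immediate, since v <= g(., y) with equality at xbar when y is in S(xbar).
   Conversely, the set C of the supergradients at xbar of the g(., y), y in
   S(xbar), is compact, hence so is co C.  Let xi be a supergradient of v, p the
   point of co C nearest to xi, and d = xi - p.  Put x_t = xbar - t d, take y_t in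
   S(x_t) and a supergradient z_t of g(., y_t) at x_t.  From
     v(xbar) <= g(xbar, y_t)  and  v(x_t) = g(x_t, y_t)
   one gets <xi, d> <= <z_t, d> + O(t), and a cluster point of (y_t, z_t) as
   t -> 0 gives z in C with <xi, d> <= <z, d>, which is impossible unless d = 0. *)
Require Import Defs.
From HB Require Import structures.
From mathcomp Require Import all_boot all_order all_algebra.
From mathcomp Require Import all_classical all_reals all_analysis.
From mathcomp Require Import ring lra.
Import Order.TTheory GRing.Theory Num.Theory.
Import numFieldNormedType.Exports.
Local Open Scope classical_set_scope.
Local Open Scope ring_scope.
Set Implicit Arguments.
Unset Strict Implicit.
Unset Printing Implicit Defensive.

(** * Euclidean inner product on row vectors, compared with the sup norm *)

Section Dot.
Context {R : realType} {n : nat}.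
Implicit Types (u v w : 'rV[R]_n) (a t : R).

Lemma dotC u v : dot u v = dot v u.
Proof. by apply: eq_bigr => i _; rewrite mulrC. Qed.

Lemma dotDr u v w : dot u (v + w) = dot u v + dot u w.
Proof. by rewrite /dot -big_split; apply: eq_bigr => i _; rewrite mxE mulrDr. Qed.

Lemma dotZr a u v : dot u (a *: v) = a * dot u v.
Proof. by rewrite /dot mulr_sumr; apply: eq_bigr => i _; rewrite mxE mulrCA. Qed.

Lemma dotNr u v : dot u (- v) = - dot u v.
Proof. by rewrite -scaleN1r dotZr mulN1r. Qed.

Lemma dotDl u v w : dot (u + v) w = dot u w + dot v w.
Proof. by rewrite !(dotC _ w) dotDr. Qed.

Lemma dotZl a u v : dot (a *: u) v = a * dot u v.
Proof. by rewrite !(dotC _ v) dotZr. Qed.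

Lemma dotNl u v : dot (- u) v = - dot u v.
Proof. by rewrite !(dotC _ v) dotNr. Qed.

Lemma sqnormD u v : sqnorm (u + v) = sqnorm u + 2 * dot u v + sqnorm v.
Proof. by rewrite /sqnorm dotDl !dotDr (dotC v u); ring. Qed.

Lemma sqnormZ a u : sqnorm (a *: u) = a ^+ 2 * sqnorm u.
Proof. by rewrite /sqnorm dotZl dotZr; ring. Qed.

Lemma sqnormN u : sqnorm (- u) = sqnorm u.
Proof. by rewrite /sqnorm dotNl dotNr opprK. Qed.

Lemma sqnorm_ge0 u : 0 <= sqnorm u.
Proof. by apply: sumr_ge0 => i _; rewrite -expr2 sqr_ge0. Qed.

Lemma mx_norm_le u a : 0 <= a -> (forall i, `|u ord0 i| <= a) -> `|u| <= a.
Proof.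
move=> a0 H; rewrite [leLHS]/Num.norm/= mx_normrE.
by apply/bigmax_leP; split => // -[i j] _ /=; rewrite (ord1 i).
Qed.

(** Each squared coordinate is one of the nonnegative summands of [sqnorm u]. This links the sup
    norm used for balls with the Euclidean quadratic terms. *)
Lemma norm_sqr_le u : `|u| ^+ 2 <= sqnorm u.
Proof.
have -> : `|u| ^+ 2 <= sqnorm u = (`|u| <= Num.sqrt (sqnorm u)).
  by rewrite -[in RHS](@ger0_norm _ `|u|)// -sqrtr_sqr ler_sqrt// sqnorm_ge0.
apply: mx_norm_le => [|i]; first exact: sqrtr_ge0.
rewrite -sqrtr_sqr ler_sqrt ?sqnorm_ge0// /sqnorm /dot (bigD1 i)//= expr2 lerDl.
by apply: sumr_ge0 => j _; rewrite -expr2 sqr_ge0.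
Qed.

Lemma sqnorm_eq0 u : sqnorm u = 0 -> u = 0.
Proof.
move=> u0; apply/eqP; rewrite -normr_eq0 -sqrf_eq0.
by rewrite eq_le sqr_ge0 -{1}u0 norm_sqr_le.
Qed.

Lemma cvg_dot {T} {F : set_system T} {FF : Filter F} (f g : T -> 'rV[R]_n) u v :
  f @ F --> u -> g @ F --> v -> (fun x => dot (f x) (g x)) @ F --> dot u v.
Proof.
move=> fu gv; apply: (@cvg_big R^o _ _ _ _ add_continuous) => i _.
have coord (h : T -> 'rV[R]_n) w : h @ F --> w ->
    (fun x => h x ord0 i) @ F --> w ord0 i.
  by move=> hw; apply: (cvg_comp h (fun M : 'rV[R]_n => M ord0 i) hw);
    exact: coord_continuous.
exact: cvgM (coord _ _ fu) (coord _ _ gv).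
Qed.

End Dot.

(** * Limits along filters and compactness *)

Lemma cvg_le {R : realFieldType} {T : Type} {F : set_system T}
    {FF : ProperFilter F} [f g : T -> R] [a b : R] :
  f @ F --> a -> g @ F --> b -> (\forall x \near F, f x <= g x) -> a <= b.
Proof.
move=> fa gb fg; rewrite -subr_ge0; apply: cvgr_to_ge (cvgB gb fa) _.
by apply: filterS fg => x; rewrite -subr_ge0.
Qed.

(* Filter form of the extraction of a convergent subsequence. *)
Lemma compact_subcvg {I : Type} {T : topologicalType} (F : set_system I)
    {FF : ProperFilter F} (u : I -> T) (K : set T) :
  compact K -> (\forall i \near F, K (u i)) ->
  exists2 G : set_system I, ProperFilter G /\ F `<=` G &
    exists2 p, K p & u @ G --> p.
Proof.
move=> cK FK; have [G [GU FG]] := ultraFilterLemma FF.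
have [p [Kp clp]] := cK (u @ G) _ (FG _ FK).
exists G; first by split => //; exact: ultra_proper.
exists p => // N pN; case: (in_ultra_setVsetC (u @^-1` N) GU) => // GN.
by have [z []] := clp (~` N) N GN pN.
Qed.

(** * Proximal supergradients *)

(** The modulus [rho] and the set [U] are fixed, instead of a constant and a neighborhood depending
    on [xi], so that the inequality survives limits of functions, base points and supergradients. *)
Definition superdiff {R : realType} {n : nat} (rho : R) (U : set 'rV[R]_n)
    (f : 'rV[R]_n -> R) (x0 : 'rV[R]_n) : set 'rV[R]_n :=
  [set xi | forall x, U x ->
     f x <= f x0 + dot xi (x - x0) + rho / 2 * sqnorm (x - x0)].

Section Superdiff.
Context {R : realType} {n : nat}.
Implicit Types (U : set 'rV[R]_n) (f : 'rV[R]_n -> R) (rho : R).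

(** The quadratic correction comes from the identity |ta + (1-t)b|^2 = t|a|^2 + (1-t)|b|^2 -
    t(1-t)|a-b|^2. *)
Lemma rho_weakly_concave_segment rho U f a b t :
  rho_weakly_concave rho U f -> U a -> U b -> 0 <= t <= 1 ->
  t * f a + (1 - t) * f b - rho / 2 * (t * (1 - t) * sqnorm (a - b)) <=
  f (t *: a + (1 - t) *: b).
Proof.
move=> fU Ua Ub /andP[t0 t1].
have := fU (Itv01 t0 t1) a b (mem_set Ua) (mem_set Ub).
rewrite convRE /conv/= /unstable.onem.
rewrite !sqnormD !sqnormZ !dotZl !dotZr sqnormN dotNr; lra.
Qed.

Lemma superdiff_convex rho U f x0 (a b : 'rV[R]_n) t :
  superdiff rho U f x0 a -> superdiff rho U f x0 b -> 0 <= t <= 1 ->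
  superdiff rho U f x0 (t *: a + (1 - t) *: b).
Proof.
move=> fa fb /andP[t0 t1] x Ux; rewrite dotDl !dotZl.
have := fa _ Ux; have := fb _ Ux; nra.
Qed.

(** For each fixed [y] both sides of the supergradient inequality converge. The function varies too,
    since the lemma is later applied to g(., y_i) with y_i converging. *)
Lemma superdiff_cvg {I : Type} (F : set_system I) {FF : ProperFilter F} rho U
    (fi : I -> 'rV[R]_n -> R) f (xi : I -> 'rV[R]_n) x (zi : I -> 'rV[R]_n) z :
  (forall y, U y -> (fun i => fi i y) @ F --> f y) ->
  (fun i => fi i (xi i)) @ F --> f x ->
  xi @ F --> x -> zi @ F --> z ->
  (\forall i \near F, superdiff rho U (fi i) (xi i) (zi i)) ->
  superdiff rho U f x z.
Proof.
move=> fif fixi xix ziz sd y Uy.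
have yx : (fun i => y - xi i) @ F --> y - x.
  by apply: cvgB => //; exact: cvg_cst.
apply: (cvg_le (fif y Uy) (g := fun i => fi i (xi i) + dot (zi i) (y - xi i)
    + rho / 2 * sqnorm (y - xi i))).
- apply: cvgD; first by apply: cvgD => //; exact: cvg_dot.
  by apply: cvgM; [exact: cvg_cst|exact: cvg_dot].
- by apply: filterS sd => i; exact.
Qed.

(** Testing the supergradient inequality at [x0] plus or minus s/2 times a basis vector bounds each
    coordinate of [z], because [f] drops there by at most L s/2. The length s/2 keeps the test
    points inside the open ball. *)
Lemma superdiff_bounded rho L s U f x0 z : 0 <= rho -> 0 <= L -> 0 < s ->
  ball x0 s `<=` U ->
  (forall x y, U x -> U y -> `|f x - f y| <= L * `|x - y|) ->
  superdiff rho U f x0 z -> `|z| <= L + rho * s.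
Proof.
move=> rho0 L0 s0 sU fL fz.
have dU w : `|w| <= s / 2 -> U (x0 + w).
  by move=> ws; apply: sU; rewrite -ball_normE/= opprD addNKr normrN; lra.
have U0 : U x0 by rewrite -[x0]addr0; apply: dU; rewrite normr0; lra.
have key i (e : R) : `|e| = 1 -> - e * z ord0 i <= L + rho * s.
  move=> e1; pose w : 'rV[R]_n := (e * (s / 2)) *: delta_mx ord0 i.
  have dotw v : dot v w = e * (s / 2) * v ord0 i.
    rewrite dotZr /dot (bigD1 i)//= big1 ?addr0 ?mxE ?eqxx ?mulr1// => j ji.
    by rewrite !mxE (negbTE ji) andbF mulr0.
  have w_le : `|w| <= s / 2.
    apply: mx_norm_le => [|j]; first by lra.
    rewrite !mxE (normrM (e * _)) (normrM e) e1 mul1r (ger0_norm (x := s / 2)); last lra.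
    by case: (_ && _); rewrite ?normr1 ?normr0; lra.
  have sqw : sqnorm w = (s / 2) ^+ 2.
    rewrite /sqnorm dotw !mxE !eqxx mulr1.
    have -> : e * (s / 2) * (e * (s / 2)) = e ^+ 2 * (s / 2) ^+ 2 by ring.
    by rewrite -(real_normK (num_real e)) e1 expr1n mul1r.
  have := fL _ _ U0 (dU _ w_le); have := fz _ (dU _ w_le).
  rewrite (addrC x0) addrK addrC opprD addrA subrr add0r normrN.
  rewrite dotw sqw.
  move=> fw; rewrite ler_norml => /andP[_ fw']; have Lw := ler_wpM2l L0 w_le.
  have : 0 <= rho * s ^+ 2 by rewrite mulr_ge0// sqr_ge0.
  rewrite -(ler_pM2r (x := s / 2)); first nra.
  lra.
apply: mx_norm_le => [|i]; last first.
  rewrite ler_norml -mulN1r.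
  have := key i 1; have := key i (-1); rewrite normrN normr1 => /(_ erefl) + /(_ erefl).
  by move=> ? ?; apply/andP; split; lra.
by have := mulr_ge0 rho0 (ltW s0); lra.
Qed.

End Superdiff.

(** * Clarke gradients and proximal supergradients *)

Section Clarke.
Context {R : realType} {n : nat}.
Implicit Types (U : set 'rV[R]_n) (f : 'rV[R]_n -> R) (rho : R).

(* In the limsup take the base points x0 - t d, so that x0 is the endpoint. *)
Lemma superdiff_clarke rho U f x0 : nbhs x0 U ->
  superdiff rho U f x0 `<=` clarke_gradient f x0.
Proof.
move=> x0U z fz d; rewrite /clarke_deriv limf_esupE.
apply: le_ereal_inf_tmp => _ [V [[A B] /= [x0A B0] ABV] <-].
apply/lee_addgt0Pr => e e0.
have tt : (fun t : R => t) @ 0^'+ --> (0 : R).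
  by apply: cvg_at_right_filter; exact: cvg_id.
have xt : (fun t : R => x0 - t *: d) @ 0^'+ --> x0.
  rewrite -[X in _ --> X]subr0 -(scale0r d).
  by apply: cvgB; [exact: cvg_cst|exact: cvgZr_tmp].
(* The difference quotient based at x0 - t d is at least <z, d> minus this error term. *)
have et : (fun t : R => rho / 2 * (t * sqnorm d)) @ 0^'+ --> (0 : R).
  rewrite [X in _ --> X](_ : 0 = rho / 2 * (0 * sqnorm d)); last by ring.
  by apply: cvgMl_tmp; exact: cvgMr_tmp.
near (0 : R)^'+ => t.
have t0 : 0 < t by near: t; exact: nbhs_right_gt.
have /= Vt : V (x0 - t *: d, t).
  apply: ABV; split => /=; [near: t; exact: xt|near: t; exact: B0].
have Ut : U (x0 - t *: d) by near: t; exact: xt.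
apply: le_trans (leeD2r _ (ereal_sup_ubound _)); last by exists (x0 - t *: d, t).
rewrite /= subrK -EFinD lee_fin.
have := fz _ Ut; rewrite (addrAC x0) subrr add0r dotNr dotZr sqnormN sqnormZ => fzt.
have et' : rho / 2 * (t * sqnorm d) < e by near: t; exact: cvgr_lt et _ e0.
rewrite -lerBlDr ler_pdivlMr//; nra.
Unshelve. all: by end_near. Qed.

(* Weak concavity on the segment from x - d to x + t d, which contains x, bounds the
   difference quotient at x, where d = x0 - z. *)
Lemma clarke_superdiff rho U f x0 : open U -> U x0 ->
  (forall x, U x -> {for x, continuous f}) -> rho_weakly_concave rho U f ->
  clarke_gradient f x0 `<=` superdiff rho U f x0.
Proof.
move=> oU Ux0 cf wf xi fxi z Uz; pose d := x0 - z.
suff : dot xi d <= f x0 - f z + rho / 2 * sqnorm d.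
  by rewrite -(opprB x0 z) dotNr sqnormN -/d; lra.
rewrite -lee_fin; apply: le_trans (fxi d) _; rewrite /clarke_deriv limf_esupE.
apply/lee_addgt0Pr => e e0; rewrite -EFinD.
(* The limsup is an infimum, over the sets of the filter, of suprema of the quotient [q]. The set
   chosen is the sublevel set of [q] at [c], so what remains is that [q p <= c] eventually. *)
set c := (_ + e); apply: ge_ereal_inf.
pose q (p : 'rV[R]_n * R) := (f (p.1 + p.2 *: d) - f p.1) / p.2.
exists (ereal_sup (EFin @` (q @` [set p | q p <= c]))); last first.
  by apply: ge_ereal_sup => _ [_ [p /= pc <-] <-]; rewrite lee_fin.
exists [set p | q p <= c]; last by rewrite -image_comp.
have F1 : (fun p : 'rV[R]_n * R => p.1) @ filter_prod (nbhs x0) 0^'+ --> x0.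
  exact: cvg_fst.
have G2 : (fun p : 'rV[R]_n * R => p.2) @ filter_prod (nbhs x0) 0^'+ --> 0^'+.
  exact: cvg_snd.
have F2 : (fun p : 'rV[R]_n * R => p.2) @ filter_prod (nbhs x0) 0^'+ --> (0 : R).
  apply: cvg_trans G2 _.
  by apply: cvg_at_right_filter; exact: cvg_id.
have Fp : (fun p : 'rV[R]_n * R => p.1 + p.2 *: d) @ filter_prod (nbhs x0) 0^'+
    --> x0.
  rewrite -[X in _ --> X]addr0 -(scale0r d).
  by apply: cvgD => //; exact: cvgZr_tmp.
have Fm : (fun p : 'rV[R]_n * R => p.1 - d) @ filter_prod (nbhs x0) 0^'+ --> z.
  rewrite -[X in _ --> X](subKr x0); apply: cvgB => //; exact: cvg_cst.
have Fd : (fun p : 'rV[R]_n * R => (1 + p.2) * sqnorm d) @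
    filter_prod (nbhs x0) 0^'+ --> sqnorm d.
  rewrite [X in _ --> X](_ : _ = (1 + 0) * sqnorm d); last by ring.
  by apply: cvgMr_tmp; apply: cvgD F2; exact: cvg_cst.
have Fc : (fun p : 'rV[R]_n * R => f p.1 - f (p.1 - d)
      + rho / 2 * ((1 + p.2) * sqnorm d)) @ filter_prod (nbhs x0) 0^'+
    --> f x0 - f z + rho / 2 * sqnorm d.
  apply: cvgD; first by apply: cvgB; [exact: cvg_comp F1 (cf _ Ux0)
    |exact: cvg_comp Fm (cf _ Uz)].
  exact: cvgMl_tmp.
near=> p => /=.
have t0 : 0 < p.2.
  by near: p; apply: (G2 [set t | 0 < t]); exact: nbhs_right_gt.
have U1 : U p.1 by near: p; apply: (F1 U); exact: open_nbhs_nbhs.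
have U2 : U (p.1 + p.2 *: d) by near: p; apply: (Fp U); exact: open_nbhs_nbhs.
have U3 : U (p.1 - d) by near: p; apply: (Fm U); exact: open_nbhs_nbhs.
apply: (@le_trans _ _ (f p.1 - f (p.1 - d) + rho / 2 * ((1 + p.2) * sqnorm d))).
  set t := p.2 in t0 U2 *; have t1 : 0 < 1 + t by lra.
  (* The weight 1/(1+t) on x + t d and t/(1+t) on x - d gives back x. *)
  have t01 : 0 <= (1 + t)^-1 <= 1.
    by rewrite invr_ge0 (ltW t1) invf_le1//; lra.
  have := rho_weakly_concave_segment wf U2 U3 t01.
  have -> : (1 + t)^-1 *: (p.1 + t *: d) + (1 - (1 + t)^-1) *: (p.1 - d) = p.1.
    by apply/rowP => i; rewrite !mxE; field; lra.
  have -> : p.1 + t *: d - (p.1 - d) = (1 + t) *: d.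
    by apply/rowP => i; rewrite !mxE; ring.
  rewrite sqnormZ /q -/t ler_pdivrMr// -(ler_pM2l t1).
  have -> : forall a b c, (1 + t) * ((1 + t)^-1 * a + (1 - (1 + t)^-1) * b -
      rho / 2 * ((1 + t)^-1 * (1 - (1 + t)^-1) * ((1 + t) ^+ 2 * c)))
      = a + t * b - rho / 2 * (t * (1 + t) * c).
    by move=> ? ? ?; field; lra.
  lra.
by near: p; apply: cvgr_le Fc _ _; rewrite /c; lra.
Unshelve. all: by end_near. Qed.

End Clarke.

(** * Continuity facts and existence of supergradients *)

Lemma continuous_subr {R : realType} {V : normedModType R} (a : V) :
  continuous (fun x : V => x - a).
Proof. by move=> x; apply: cvgB; [exact: cvg_id|exact: cvg_cst]. Qed.

Lemma continuous_subZ {R : realType} {T : topologicalType} (f h : T -> R) (k : R) x :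
  {for x, continuous f} -> {for x, continuous h} ->
  {for x, continuous (fun y => f y - k * h y)}.
Proof. by move=> cf ch; apply: cvgB cf _; exact: cvgMl_tmp. Qed.

Lemma compact_norm_le {R : realType} {n : nat} (x0 : 'rV[R]_n) (M : R) :
  compact [set x | `|x - x0| <= M].
Proof.
apply: bounded_closed_compact.
  exists (M + `|x0|); split=> [|N /ltW MN x /= xM]; first exact: num_real.
  by apply: le_trans MN; rewrite -[x](subrK x0) (le_trans (ler_normD _ _))// lerD2r.
exact: (preimage_closed (fun x _ => cvg_norm (@continuous_subr _ _ x0 x))
  (@closed_le _ M)).
Qed.

Lemma lipschitz_continuous_for {R : realType} {V : normedModType R} (L : R)
    (U : set V) (f : V -> R) x : nbhs x U ->
  (forall x y, U x -> U y -> `|f x - f y| <= L * `|x - y|) ->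
  {for x, continuous f}.
Proof.
move=> xU fL; have Ux := nbhs_singleton xU; apply/cvgrPdist_le => e e0.
have d0 : 0 < e / (`|L| + 1) by rewrite divr_gt0// ltr_wpDl.
near=> y; have Uy : U y by near: y.
apply: le_trans (fL _ _ Ux Uy) _.
have xy : `|x - y| <= e / (`|L| + 1).
  by near: y; exact: (cvgr_dist_le id x cvg_id) d0.
apply: le_trans (_ : (`|L| + 1) * `|x - y| <= _).
  by rewrite ler_wpM2r// (le_trans (ler_norm _))// lerDl.
by rewrite mulrC -ler_pdivlMr// ltr_wpDl.
Unshelve. all: by end_near. Qed.

Section SuperdiffExists.
Context {R : realType} {n : nat}.
Implicit Types (U : set 'rV[R]_n) (f : 'rV[R]_n -> R) (rho : R).

Lemma continuous_sqnorm_subr (x0 : 'rV[R]_n) :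
  continuous (fun x : 'rV[R]_n => sqnorm (x - x0)).
Proof.
move=> x; have xx := @continuous_subr R 'rV[R]_n x0 x; exact (cvg_dot xx xx).
Qed.

(** Maximality is only local, but x + t(z - x) lies in [K] for small t. Comparing maximality there
    with weak concavity on the segment from x to z, dividing by t and letting t tend to 0 gives the
    inequality at every z in [U]. *)
Lemma prox_superdiff rho U f k (K : set 'rV[R]_n) x0 x :
  rho_weakly_concave rho U f -> U x -> nbhs x K ->
  (forall y, K y -> f y - k / 2 * sqnorm (y - x0) <=
                    f x - k / 2 * sqnorm (x - x0)) ->
  superdiff rho U f x (k *: (x - x0)).
Proof.
move=> wf Ux xK xmax z Uz; set c := sqnorm (z - x).
have tt : (fun t : R => t) @ 0^'+ --> (0 : R).
  by apply: cvg_at_right_filter; exact: cvg_id.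
have zx : (fun t : R => t *: (z - x) + x) @ 0^'+ --> x.
  rewrite -[X in _ --> X]add0r -(scale0r (z - x)).
  by apply: cvgD; [exact: cvgZr_tmp|exact: cvg_cst].
have lim : (fun t : R => f x + dot (k *: (x - x0)) (z - x) + rho / 2 * c
      + t * ((k - rho) / 2 * c)) @ 0^'+
    --> f x + dot (k *: (x - x0)) (z - x) + rho / 2 * c.
  rewrite -[X in _ --> X]addr0 -[X in _ --> _ + X](mul0r ((k - rho) / 2 * c)).
  by apply: cvgD; [exact: cvg_cst|exact: cvgMr_tmp].
apply: cvgr_to_ge lim _; near=> t.
have t0 : 0 < t by near: t; exact: nbhs_right_gt.
have t1 : t <= 1 by near: t; exact: nbhs_right_le.
have Kt : K (t *: (z - x) + x) by near: t; exact: zx.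
have t01 : 0 <= t <= 1 by rewrite ltW.
have := rho_weakly_concave_segment wf Uz Ux t01.
have -> : t *: z + (1 - t) *: x = t *: (z - x) + x.
  by apply/rowP => i; rewrite !mxE; ring.
have := xmax _ Kt.
have -> : t *: (z - x) + x - x0 = (x - x0) + t *: (z - x).
  by apply/rowP => i; rewrite !mxE; ring.
rewrite sqnormD sqnormZ dotZl dotZr -/c => h1 h2.
rewrite -(ler_pM2l t0); nra.
Unshelve. all: by end_near. Qed.

(* Proximal approximation: the maximizers x_k of f - k/2 |. - x0|^2 near x0 satisfy
   |x_k - x0| = O(1/k), and k (x_k - x0) is a supergradient of f at x_k. *)
Lemma superdiff_nonempty rho L U f x0 : open U -> U x0 ->
  (forall x y, U x -> U y -> `|f x - f y| <= L * `|x - y|) ->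
  rho_weakly_concave rho U f -> superdiff rho U f x0 !=set0.
Proof.
move=> oU Ux0 fL wf.
have cf x : U x -> {for x, continuous f}.
  by move=> Ux; apply: lipschitz_continuous_for fL; exact: open_nbhs_nbhs.
have /nbhs_ballP[r /= r0 rU] : nbhs x0 U by exact: open_nbhs_nbhs.
pose K := [set x | `|x - x0| <= r / 2].
have KU : K `<=` U.
  by move=> x Kx; apply: rU; rewrite -ball_normE/= distrC; move: Kx; rewrite /K/=; lra.
have K0 : K x0 by rewrite /K/= subrr normr0; lra.
have cK : compact K by exact: compact_norm_le.
have /choice[x_ xP] (k : nat) : exists x, K x /\ forall y, K y ->
    f y - k.+1%:R / 2 * sqnorm (y - x0) <= f x - k.+1%:R / 2 * sqnorm (x - x0).
  have [|//||x /set_mem Kx xmax] := @EVT_max_rV R n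
      (fun x => f x - k.+1%:R / 2 * sqnorm (x - x0)) K; first by exists x0.
  - apply: continuous_in_subspaceT => x /set_mem Kx.
    exact: (@continuous_subZ R _ f (fun x => sqnorm (x - x0)) (k.+1%:R / 2) x
      (cf _ (KU _ Kx)) (@continuous_sqnorm_subr x0 x)).
  - by exists x; split => // y Ky; apply: xmax; exact: mem_set.
(* Comparing the maximal value with the value at [x0] gives k/2 |x_k - x0|^2 <= f(x_k) - f(x0) <=
   L|x_k - x0|, with [k.+1] for k. The absolute value of [L] appears because its sign is not
   assumed. *)
have x_le k : k.+1%:R * `|x_ k - x0| <= 2 * `|L|.
  have [Kx /(_ x0 K0)] := xP k.
  rewrite subrr [sqnorm 0]big1 => [|i _]; last by rewrite mxE mul0r.
  have := fL _ _ (KU _ Kx) Ux0; rewrite ler_norml => /andP[_].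
  have := norm_sqr_le (x_ k - x0); have := normr_ge0 (x_ k - x0).
  have := ler_norm L; have : (0 : R) < k.+1%:R by rewrite ltr0n.
  set N := `|_ - _|; set q := sqnorm _; set c : R := k.+1%:R => c0 LL N0 Nq fN fk.
  have : c * N * N <= 2 * `|L| * N by nra.
  have [->|N1] := eqVneq N 0; first by rewrite !mulr0 mulr_ge0.
  by rewrite ler_pM2r// lt_neqAle eq_sym N1 N0.
have xx0 : x_ @ \oo --> x0.
  suff h0 : (fun k => `|x_ k - x0|) @ \oo --> (0 : R).
    apply/cvgrPdist_le => e e0; near=> k; rewrite distrC.
    by near: k; exact: cvgr_le h0 _ e0.
  apply: (@squeeze_cvgr _ _ _ _ (fun=> 0) (fun k => 2 * `|L| * harmonic k)).
  - apply: nearW => k; rewrite normr_ge0 /= /harmonic ler_pdivlMr ?ltr0n//.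
    by rewrite mulrC.
  - exact: cvg_cst.
  - rewrite -[X in _ --> X](mulr0 (2 * `|L|)).
    by apply: cvgMl_tmp; exact: cvg_harmonic.
pose eta k := k.+1%:R *: (x_ k - x0).
have [|G [GF ooG] [z _ etaz]] := compact_subcvg (F := \oo) (u := eta)
  (@compact_norm_le R n 0 (2 * `|L|)).
  by apply: nearW => k /=; rewrite subr0 normrZ ger0_norm.
have Gx : x_ @ G --> x0 by apply: cvg_trans xx0; exact: cvg_app.
exists z; apply: (superdiff_cvg (F := G) (fi := fun _ => f) _ _ Gx etaz).
- by move=> y Uy; exact: cvg_cst.
- exact: cvg_comp Gx (cf _ Ux0).
apply: ooG; near=> k.
(* For large k the maximizer is interior to [K], as [prox_superdiff] requires. *)
have xk : nbhs (x_ k) K.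
  near: k; apply: (xx0 K°); apply: nbhs_interior; apply/nbhs_ballP.
  by exists (r / 2) => [/=|y]; [lra|rewrite -ball_normE/= distrC => /ltW].
by apply: prox_superdiff xk (xP k).2 => //; exact/KU/(xP k).1.
Unshelve. all: end_near. Qed.

End SuperdiffExists.

(** * Convex hulls: Caratheodory's theorem and compactness *)

Lemma continuous_segment {R : realType} {V : normedModType R} :
  continuous (fun p : R * V * V => p.1.1 *: p.1.2 + (1 - p.1.1) *: p.2).
Proof.
move=> p.
have pr1 (T U : topologicalType) (q : T * U) : fst @ q --> q.1 by exact: cvg_fst.
have pr2 (T U : topologicalType) (q : T * U) : snd @ q --> q.2 by exact: cvg_snd.
have p1 := cvg_comp _ _ (pr1 _ _ p) (pr1 _ _ p.1).
have p2 := cvg_comp _ _ (pr1 _ _ p) (pr2 _ _ p.1).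
apply: cvgD; first exact: cvgZ p1 p2.
apply: cvgZ; last exact: pr2.
by apply: cvgB; [exact: cvg_cst|exact: p1].
Qed.

Section ConvexHull.
Context {R : realType} {n : nat}.
Implicit Types (A : set 'rV[R]_n).

Lemma convex_setP A : convex_set (A : set (convex_lmodType 'rV[R]_n)) <->
  forall a b t, A a -> A b -> 0 <= t <= 1 -> A (t *: a + (1 - t) *: b).
Proof.
split=> [cA a b t Aa Ab /andP[t0 t1]|cA a b t /set_mem Aa /set_mem Ab].
  exact: set_mem (cA a b (Itv01 t0 t1) (mem_set Aa) (mem_set Ab)).
by apply/mem_set; apply: cA => //; apply/andP; split.
Qed.

Lemma sub_convex_hull A : A `<=` convex_hull A.
Proof. exact: sub_gen_smallest. Qed.

Lemma convex_convex_hull A : convex_set (convex_hull A : set (convex_lmodType 'rV[R]_n)).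
Proof.
move=> a b t /set_mem ha /set_mem hb; apply/mem_set => C [cC AC].
by apply/set_mem/cC; apply/mem_set; [exact: ha|exact: hb].
Qed.

Lemma convex_hull_min A (C : set 'rV[R]_n) :
  convex_set (C : set (convex_lmodType 'rV[R]_n)) -> A `<=` C -> convex_hull A `<=` C.
Proof. by move=> cC AC x; apply. Qed.

Definition convex_comb A k (x : 'rV[R]_n) :=
  exists (w : 'I_k -> R) (a : 'I_k -> 'rV[R]_n),
  [/\ forall i, 0 <= w i, \sum_i w i = 1, forall i, A (a i) & x = \sum_i w i *: a i].

Lemma convex_comb_conv A k l x y t : convex_comb A k x -> convex_comb A l y ->
  0 <= t <= 1 -> convex_comb A (k + l) (t *: x + (1 - t) *: y).
Proof.
move=> [w [a [w0 w1 Aa ->]]] [v [b [v0 v1 Ab ->]]] /andP[t0 t1].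
have sl i : fintype.split (lshift l i) = inl i := unsplitK (inl i).
have sr i : fintype.split (rshift k i) = inr i := unsplitK (inr i).
exists (fun i => match fintype.split i with inl i => t * w i | inr j => (1 - t) * v j end).
exists (fun i => match fintype.split i with inl i => a i | inr j => b j end).
split.
- by move=> i; case: fintype.split => j; rewrite mulr_ge0// subr_ge0.
- rewrite big_split_ord/=.
  under eq_bigr do rewrite sl; under [X in _ + X]eq_bigr do rewrite sr.
  by rewrite -!mulr_sumr w1 v1 !mulr1 addrC subrK.
- by move=> i; case: fintype.split.
- rewrite big_split_ord/=.
  under [X in _ = X + _]eq_bigr do rewrite sl -scalerA.
  under [X in _ = _ + X]eq_bigr do rewrite sr -scalerA.
  by rewrite -!scaler_sumr.
Qed.

(** More than n + 1 points are affinely dependent. Subtracting a suitable multiple of the dependence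
    from the weights makes one of them vanish and keeps the others nonnegative. *)
Lemma convex_comb_reduce A k x : (n < k)%N -> convex_comb A k.+1 x -> convex_comb A k x.
Proof.
move=> nk [w [a [w0 w1 Aa ->]]].
have [u [u_neq0 ua u1]] : exists u : 'I_k.+1 -> R,
    [/\ exists i, u i != 0, \sum_i u i *: a i = 0 & \sum_i u i = 0].
  (* The rows are the points with an extra coordinate 1, so a left kernel vector is an affine
     dependence. One exists because there are more rows than columns. *)
  pose B : 'M[R]_(k.+1, n + 1) := row_mx (\matrix_i a i) (const_mx 1).
  have /rowV0Pn[u /sub_kermxP uB u0] : kermx B != 0.
    rewrite -mxrank_eq0 mxrank_ker subn_eq0 -ltnNge.
    by rewrite (leq_ltn_trans (rank_leq_col B))// addn1 ltnS.
  rewrite mul_mx_row in uB.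
  have := congr1 lsubmx uB; rewrite row_mxKl linear0 => ua.
  have := congr1 rsubmx uB; rewrite row_mxKr linear0 => u1.
  exists (u ord0); split.
  - by move/rV0Pn: u0.
  - by move: ua; rewrite mulmx_sum_row; under eq_bigr do rewrite rowK.
  - have : (u *m const_mx 1 : 'rV[R]_1) ord0 ord0 = 0 by rewrite u1 mxE.
    by rewrite mxE; under eq_bigr do rewrite mxE mulr1.
have [i1 i1P] : exists i, 0 < u i.
  apply: contrapT => /forallNP u_le0; case: u_neq0 => i /eqP; apply.
  have Nu j : 0 <= - u j by rewrite oppr_ge0 leNgt; apply/negP.
  have : \sum_j - u j = 0 by rewrite sumrN u1 oppr0.
  move/eqP; rewrite psumr_eq0 => [/allP/(_ i)|//].
  by rewrite mem_index_enum oppr_eq0 => /(_ isT)/eqP.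
(* The least ratio w_i/u_i over u_i > 0 is the largest t for which all w_i - t u_i stay nonnegative;
   the weight at [i0] is then 0. *)
case: (@Order.TotalTheory.arg_minP _ _ _ i1 (fun i => 0 < u i) (fun i => w i / u i) i1P)
  => i0 ui0 i0min.
set t := w i0 / u i0 in i0min.
have t0 : 0 <= t by rewrite divr_ge0// ltW.
have w'0 i : 0 <= w i - t * u i.
  have [ui|ui] := ltP 0 (u i); last by have := w0 i; nra.
  by rewrite subr_ge0 -ler_pdivlMr//; exact: i0min.
have w'i0 : w i0 - t * u i0 = 0 by rewrite /t divfK ?subrr// gt_eqF.
exists (fun j => w (lift i0 j) - t * u (lift i0 j)), (a \o lift i0); split => //=.
- have : \sum_i (w i - t * u i) = 1 by rewrite sumrB -mulr_sumr u1 mulr0 subr0.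
  by rewrite (bigD1_ord i0)//= w'i0 add0r.
- have : \sum_i (w i - t * u i) *: a i = \sum_i w i *: a i.
    under eq_bigr do rewrite scalerBl -scalerA.
    by rewrite sumrB -scaler_sumr ua scaler0 subr0.
  by rewrite (bigD1_ord i0)//= w'i0 scale0r add0r => ->.
Qed.

(** Finite convex combinations of all lengths form a convex set containing [A], hence contain the
    hull; [convex_comb_reduce] then shortens them. Length 0 is excluded because an empty sum of
    weights is not 1. *)
Lemma caratheodory A x : convex_hull A x -> exists2 k, (k <= n)%N & convex_comb A k.+1 x.
Proof.
move=> /(@convex_hull_min A [set y | exists k, convex_comb A k y]) [].
- apply/convex_setP => a b t [k ka] [l lb] t01.
  by exists (k + l)%N; exact: convex_comb_conv.
- move=> a Aa; exists 1%N, (fun=> 1), (fun=> a).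
  by rewrite !big_ord1 scale1r; split.
move=> k; elim: k => [[w [a [_ + _ _]]]|k IH xk].
  by rewrite big_ord0 => /esym/eqP; rewrite oner_eq0.
have [kn|nk] := leqP k n; first by exists k.
by apply: IH; exact: convex_comb_reduce xk.
Qed.

(* By Caratheodory's theorem the n-th iterate is the whole convex hull; each iterate
   is a continuous image of a product of compact sets. *)
Fixpoint iter_conv A k : set 'rV[R]_n :=
  if k is k'.+1 then
    (fun p : R * 'rV[R]_n * 'rV[R]_n => p.1.1 *: p.1.2 + (1 - p.1.1) *: p.2) @`
      (`[0, 1] `*` A `*` iter_conv A k')
  else A.

Lemma compact_iter_conv A k : compact A -> compact (iter_conv A k).
Proof.
move=> cA; elim: k => //= k IH; apply: continuous_compact.
  exact/continuous_subspaceT/continuous_segment.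
by apply: compact_setX => //; apply: compact_setX => //; exact: segment_compact.
Qed.

Lemma iter_conv_sub_hull A k : iter_conv A k `<=` convex_hull A.
Proof.
elim: k => [|k IH] /=; first exact: sub_convex_hull.
move=> _ [[[t a] b] /= [[t01 Aa] kb] <-].
have /convex_setP := @convex_convex_hull A; apply; first exact: sub_convex_hull.
  exact: IH.
by move: t01; rewrite in_itv.
Qed.

Lemma iter_conv_mono A k l : A !=set0 -> (k <= l)%N -> iter_conv A k `<=` iter_conv A l.
Proof.
move=> [a Aa] /subnKC <-; elim: (l - k)%N => [|j IH]; first by rewrite addn0.
apply: (subset_trans IH) => x kx; rewrite addnS.
(* A point of [A] taken with weight 0 adds one level without moving [x]. *)
exists (0, a, x); last by rewrite /= scale0r add0r subr0 scale1r.
by split => //; split => //=; rewrite in_itv/= lexx ler01.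
Qed.

(** Split off the first point and renormalize the remaining weights by their sum 1 - s. *)
Lemma convex_comb_iter_conv A k x : convex_comb A k.+1 x -> iter_conv A k x.
Proof.
elim: k x => [|k IH] x [w [a [w0 w1 Aa ->]]].
  by move: w1; rewrite !big_ord1 => ->; rewrite scale1r /=; exact: Aa.
rewrite big_ord_recl; rewrite big_ord_recl in w1; set s := w ord0 in w1 *.
have sE : \sum_(i < k.+1) w (lift ord0 i) = 1 - s by rewrite -w1 addrC addKr.
have s1 : 0 <= 1 - s by rewrite -sE; apply: sumr_ge0.
have s01 : `[0, 1]%classic s by rewrite /= in_itv/= w0 -subr_ge0.
(* If s = 1 there is nothing to renormalize: the other weights are all 0, and the first point itself
   serves as the second endpoint. *)
have [s0|s_neq0] := eqVneq (1 - s) 0.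
  exists (s, a ord0, a ord0).
    split => /=; first by split; [exact: s01|exact: Aa].
    exact: (@iter_conv_mono A 0 k (ex_intro _ _ (Aa ord0)) isT).
  rewrite /= s0 scale0r big1 // => i _.
  have /eqP := sE; rewrite s0 psumr_eq0 => [/allP/(_ i)|//].
  by rewrite mem_index_enum => /(_ isT)/eqP ->; rewrite scale0r.
exists (s, a ord0, \sum_i (w (lift ord0 i) / (1 - s)) *: a (lift ord0 i)).
  split => /=; first by split; [exact: s01|exact: Aa].
  apply: IH; exists (fun i => w (lift ord0 i) / (1 - s)), (a \o lift ord0).
  split => //= [i|]; first by rewrite divr_ge0 ?w0.
  by rewrite -mulr_suml sE divff.
congr (_ + _); rewrite scaler_sumr; apply: eq_bigr => i _.
by rewrite scalerA mulrCA divff// mulr1.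
Qed.

Lemma compact_convex_hull A : compact A -> compact (convex_hull A).
Proof.
(* The empty set is treated apart because monotonicity of the iterates needs a point of [A]. *)
move=> cA; have [->|/set0P A0] := eqVneq A set0.
  suff -> : @convex_hull R n set0 = set0 by exact: compact0.
  by apply/seteqP; split => //; apply: convex_hull_min => // a b t /set_mem.
suff -> : convex_hull A = iter_conv A n by exact: compact_iter_conv.
apply/seteqP; split; last exact: iter_conv_sub_hull.
move=> x /caratheodory[k kn /convex_comb_iter_conv]; exact: iter_conv_mono.
Qed.

End ConvexHull.

(** * The value function: attainment, Lipschitz bound, weak concavity *)

Lemma min_valueE {R : realType} {T : Type} (Y : set T) (f : T -> R) y :
  argmin Y f y -> min_value Y f = f y.
Proof.
move=> [Yy ymin]; apply/le_anti/andP; split.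
  by apply: ge_inf; [exists (f y) => _ [z Yz <-]; exact: ymin|exists y].
by apply: lb_le_inf; [exists (f y), y|move=> _ [z Yz <-]; exact: ymin].
Qed.

Section ValueFunction.
Context {R : realType} {n m : nat} (Y OY : set 'rV[R]_m) (U : set 'rV[R]_n)
  (g : 'rV[R]_n -> 'rV[R]_m -> R) (L : R).
Context (Y0 : Y !=set0) (Yc : closed Y) (YO : Y `<=` OY) (oO : open OY)
  (L0 : 0 <= L)
  (lev : level_bounded_locally_uniformly Y g)
  (gL : forall p q, (U `*` OY) p -> (U `*` OY) q ->
     `|g p.1 p.2 - g q.1 q.2| <= L * `|p - q|).

Let v x := min_value Y (g x).

Lemma lipschitz_fst x x' y : U x -> U x' -> OY y ->
  `|g x y - g x' y| <= L * `|x - x'|.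
Proof.
move=> Ux Ux' Oy; have := gL (p := (x, y)) (q := (x', y)) (conj Ux Oy) (conj Ux' Oy).
by rewrite prod_normE/= subrr normr0 max_l.
Qed.

Lemma lipschitz_snd x y y' : U x -> OY y -> OY y' ->
  `|g x y - g x y'| <= L * `|y - y'|.
Proof.
move=> Ux Oy Oy'; have := gL (p := (x, y)) (q := (x, y')) (conj Ux Oy) (conj Ux Oy').
by rewrite prod_normE/= subrr normr0 max_r.
Qed.

Lemma level_bound x M : exists r N : R, 0 < r /\
  forall x' y, ball x r x' -> Y y -> g x' y <= M -> `|y| <= N.
Proof.
(* [bounded_set] gives a bound by every number strictly above [N], hence N + 1. *)
have [r r0 [N [_ NP]]] := lev x M; exists r, (N + 1); split => // x' y xx' Yy gM.
have : `|(x', y)| <= N + 1 by apply: NP => //; rewrite ltrDl.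
by apply: le_trans; rewrite prod_normE/= le_max lexx orbT.
Qed.

(** Level-boundedness puts all y in [Y] with g(x, y) <= g(x, y0) into a compact part of [Y]. A
    minimizer there beats [y0], and so every point left out. *)
Lemma argmin_nonempty x : U x -> exists y, argmin Y (g x) y.
Proof.
move=> Ux; have [y0 Yy0] := Y0; have [r [N [r0 bN]]] := level_bound x (g x y0).
pose K := Y `&` [set y | `|y - 0| <= N].
have bK y : Y y -> g x y <= g x y0 -> K y.
  by move=> Yy gy; split => //=; rewrite subr0; apply: bN gy => //; exact: ballxx.
have cK : compact K.
  by rewrite /K setIC; apply: compact_closedI => //; exact: compact_norm_le.
have [|//||y /set_mem[Yy _] ymin] := @EVT_min_rV R m (g x) K.
- by exists y0; exact: bK.
- apply: continuous_in_subspaceT => y /set_mem[Yy _].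
  apply: (@lipschitz_continuous_for R _ L OY); last by move=> *; exact: lipschitz_snd.
  by apply: open_nbhs_nbhs; split => //; exact: YO.
exists y; split => // z Yz; have [zy0|y0z] := leP (g x z) (g x y0).
  by apply: ymin; exact/mem_set/bK.
by apply: (le_trans (ymin y0 _)); [exact/mem_set/bK|exact: ltW].
Qed.

Lemma value_le x y : U x -> Y y -> v x <= g x y.
Proof. by move=> /argmin_nonempty[z zP]; rewrite /v (min_valueE zP) => /zP.2. Qed.

(** A minimizer at one point is a competitor at the other, so [v] inherits the constant [L] of g(.,
    y). *)
Lemma value_lipschitz x x' : U x -> U x' -> `|v x - v x'| <= L * `|x - x'|.
Proof.
have H z z' : U z -> U z' -> v z - v z' <= L * `|z - z'|.
  move=> Uz Uz'; have [y yP] := argmin_nonempty Uz'.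
  rewrite {2}/v (min_valueE yP); have := value_le Uz yP.1.
  have := lipschitz_fst Uz Uz' (YO yP.1); rewrite ler_norml => /andP[_]; lra.
move=> Ux Ux'; rewrite ler_norml; have := H _ _ Ux Ux'; have := H _ _ Ux' Ux.
by rewrite distrC => ? ?; apply/andP; split; lra.
Qed.

(** A minimizer at the intermediate point is a competitor at both endpoints, and the modulus [rho]
    is the same for all y. *)
Lemma value_weakly_concave rho :
  convex_set (U : set (convex_lmodType 'rV[R]_n)) ->
  (forall y, OY y -> rho_weakly_concave rho U (g^~ y)) ->
  rho_weakly_concave rho U v.
Proof.
move=> cU wg t a b /[dup] /set_mem Ua aU /[dup] /set_mem Ub bU.
have [y yP] := argmin_nonempty (set_mem (cU a b t aU bU)).
rewrite {1}/v (min_valueE yP); apply: le_trans (wg y (YO yP.1) t a b aU bU) _.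
rewrite !convRE; apply: lerD; apply: ler_wpM2l => //; rewrite ?lerD2r ?lerN2.
- exact: value_le yP.1.
- by rewrite /unstable.onem subr_ge0.
- exact: value_le yP.1.
Qed.

End ValueFunction.

(** * Supergradients of the value function *)

Lemma lipschitz_pair_cvg {R : realType} {V W : normedModType R} (U : set V)
    (O : set W) (g : V -> W -> R) (L : R) {I : Type} (F : set_system I)
    {FF : Filter F} (xi : I -> V) (yi : I -> W) x y :
  nbhs x U -> nbhs y O ->
  (forall p q, (U `*` O) p -> (U `*` O) q ->
     `|g p.1 p.2 - g q.1 q.2| <= L * `|p - q|) ->
  xi @ F --> x -> yi @ F --> y -> (fun i => g (xi i) (yi i)) @ F --> g x y.
Proof.
move=> xU yO gL xix yiy.
have xy : (fun i => (xi i, yi i)) @ F --> (x, y) by exact: cvg_pair.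
have cg : {for (x, y), continuous (fun p => g p.1 p.2)}.
  by apply: (@lipschitz_continuous_for R _ L (U `*` O)) => //; exists (U, O).
exact: (cvg_comp (fun i => (xi i, yi i)) (fun p => g p.1 p.2) xy cg).
Qed.

Section Danskin.
Context {R : realType} {n m : nat} (Y OY : set 'rV[R]_m) (U : set 'rV[R]_n)
  (g : 'rV[R]_n -> 'rV[R]_m -> R) (L rho r : R) (xbar : 'rV[R]_n).
Context (Y0 : Y !=set0) (Yc : closed Y) (YO : Y `<=` OY) (oO : open OY)
  (oU : open U) (r0 : 0 < r) (rU : ball xbar r `<=` U) (L0 : 0 <= L) (rho0 : 0 <= rho)
  (lev : level_bounded_locally_uniformly Y g)
  (gL : forall p q, (U `*` OY) p -> (U `*` OY) q ->
     `|g p.1 p.2 - g q.1 q.2| <= L * `|p - q|)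
  (wg : forall y, OY y -> rho_weakly_concave rho U (g^~ y)).

Let v x := min_value Y (g x).
Let C := [set z | exists2 y, argmin Y (g xbar) y & superdiff rho U (g^~ y) xbar z].
Let Ux : U xbar. Proof. exact/rU/ballxx. Qed.

Lemma joint_cvg {I : Type} (F : set_system I) {FF : Filter F}
    (xi : I -> 'rV[R]_n) (yi : I -> 'rV[R]_m) x y :
  U x -> OY y -> xi @ F --> x -> yi @ F --> y ->
  (fun i => g (xi i) (yi i)) @ F --> g x y.
Proof.
by move=> Ux' Oy; apply: (lipschitz_pair_cvg _ _ gL); exact: open_nbhs_nbhs.
Qed.

(** Level-boundedness confines the minimizers, and [B] the supergradients, to a compact set;
    optimality and the supergradient inequality pass to the limit. It serves both for base points
    tending to [xbar] and, with a constant base point, for the compactness of [C]. *)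
Lemma argmin_superdiff_cvg {I : Type} (F : set_system I) {FF : ProperFilter F}
    (xi : I -> 'rV[R]_n) (yi : I -> 'rV[R]_m) (zi : I -> 'rV[R]_n) (B : R) :
  xi @ F --> xbar ->
  (\forall i \near F, U (xi i) /\ argmin Y (g (xi i)) (yi i)) ->
  (\forall i \near F, superdiff rho U (g^~ (yi i)) (xi i) (zi i)) ->
  (\forall i \near F, `|zi i| <= B) ->
  exists2 G : set_system I, ProperFilter G /\ F `<=` G &
    exists2 z, C z & zi @ G --> z.
Proof.
move=> xix Fy Fz FB; have [y0 Yy0] := Y0.
(* The margin 1 makes g(x_i, y_i) <= g(x_i, y0) <= g(xbar, y0) + 1 hold eventually. *)
have [s [N [s0 bN]]] := level_bound lev xbar (g xbar y0 + 1).
pose K := (Y `&` [set y | `|y - 0| <= N]) `*` [set z : 'rV[R]_n | `|z - 0| <= B].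
have cK : compact K.
  apply: compact_setX; last exact: compact_norm_le.
  by rewrite setIC; apply: compact_closedI => //; exact: compact_norm_le.
have gy0 : (fun i => g (xi i) y0) @ F --> g xbar y0.
  by apply: joint_cvg => //; [exact: YO|exact: cvg_cst].
have FK : \forall i \near F, K (yi i, zi i).
  near=> i; have [Ui [Yi yimin]] : U (xi i) /\ argmin Y (g (xi i)) (yi i).
    by near: i.
  split => /=; rewrite ?subr0; last by near: i.
  split => //=; apply: (bN (xi i)) => //.
    by near: i; apply: (xix (ball xbar s)); exact: nbhsx_ballx.
  apply: (le_trans (yimin _ Yy0)).
  by near: i; apply: cvgr_le gy0 _ _; lra.
have [G [GF FG] [[y z] [[Yy _] _] Gyz]] := compact_subcvg (FF := FF) cK FK.
have Gx : xi @ G --> xbar by apply: cvg_trans xix; exact: cvg_app.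
have Gy : yi @ G --> y by exact: (cvg_comp _ _ Gyz cvg_fst).
have Gz : zi @ G --> z by exact: (cvg_comp _ _ Gyz cvg_snd).
exists G => //; exists z => //; exists y.
  split => // w Yw.
  apply: (@cvg_le _ _ G _ (fun i => g (xi i) (yi i)) (fun i => g (xi i) w)).
  - by apply: joint_cvg => //; exact: YO.
  - by apply: joint_cvg => //; [exact: YO|exact: cvg_cst].
  - by apply: FG; apply: filterS Fy => i [_ [_]]; exact.
apply: (superdiff_cvg (F := G) (fi := fun i => g^~ (yi i)) _ _ Gx Gz).
- by move=> x Ux'; apply: joint_cvg => //; [exact: YO|exact: cvg_cst].
- by apply: joint_cvg => //; exact: YO.
- exact: FG.
Unshelve. all: by end_near. Qed.

(** The ball of radius r/2 around x stays in [U], so the bound is uniform in x and y. *)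
Lemma argmin_superdiff_bounded x y z : ball xbar (r / 2) x -> OY y ->
  superdiff rho U (g^~ y) x z -> `|z| <= L + rho * (r / 2).
Proof.
move=> bx Oy; apply: superdiff_bounded => //.
- by rewrite divr_gt0.
- by move=> w xw; apply: rU; exact: ball_split bx xw.
- by move=> x1 x2 U1 U2; exact: (lipschitz_fst gL).
Qed.

Lemma superdiff_value_dir xi d : superdiff rho U v xbar xi ->
  exists2 z, C z & dot xi d <= dot z d.
Proof.
move=> vxi.
(* The points x_t lie in [U] only for small t; elsewhere the choice functions take the dummy value
   0. *)
have /choice[y_ yP] x : exists y, U x -> argmin Y (g x) y.
  have [Ux'|nU] := pselect (U x); last by exists 0.
  by have [y yP] := argmin_nonempty Y0 Yc YO oO lev gL Ux'; exists y.
have /choice[z_ zP] x : exists z, U x -> superdiff rho U (g^~ (y_ x)) x z.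
  have [Ux'|nU] := pselect (U x); last by exists 0.
  have Oy : OY (y_ x) by exact/YO/(yP x Ux').1.
  suff [z zP] : superdiff rho U (g^~ (y_ x)) x !=set0 by exists z.
  by apply: (superdiff_nonempty (L := L)) (wg Oy) => // *; exact: (lipschitz_fst gL).
have tt : (fun t : R => t) @ 0^'+ --> (0 : R).
  by apply: cvg_at_right_filter; exact: cvg_id.
pose x_ (t : R) := xbar - t *: d.
have xx : x_ @ 0^'+ --> xbar.
  rewrite -[X in _ --> X]subr0 -(scale0r d).
  by apply: cvgB; [exact: cvg_cst|exact: cvgZr_tmp].
have near_ball : \forall t \near 0^'+, ball xbar (r / 2) (x_ t).
  by apply: (xx (ball xbar (r / 2))); apply: nbhsx_ballx; rewrite divr_gt0.
have nearU : \forall t \near 0^'+, U (x_ t).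
  by apply: (xx U); exact: open_nbhs_nbhs.
have [|||G [GF FG] [z Cz Gz]] :=
    @argmin_superdiff_cvg _ (0 : R)^'+ _ x_ (y_ \o x_) (z_ \o x_) (L + rho * (r / 2)) xx.
- by apply: filterS nearU => t Ut; split => //; exact: yP.
- by apply: filterS nearU => t Ut; exact: zP.
- near=> t; have Ut : U (x_ t) by near: t.
  apply: argmin_superdiff_bounded (zP _ Ut); first by near: t.
  exact/YO/(yP _ Ut).1.
exists z => //.
(* The error t rho |d|^2 collects the quadratic terms of the two supergradient inequalities, each
   rho/2 t^2 |d|^2, after division by t. *)
apply: (@cvg_le _ _ G _ (fun t => dot xi d - t * (rho * sqnorm d))
                        (fun t => dot (z_ (x_ t)) d)).
- rewrite -[X in _ --> X]subr0 -[X in _ --> _ - X](mul0r (rho * sqnorm d)).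
  apply: cvgB; first exact: cvg_cst.
  by apply: cvgMr_tmp; apply: cvg_trans tt; exact: cvg_app.
- by apply: cvg_dot; [exact: Gz|exact: cvg_cst].
apply: FG; near=> t.
have t0 : 0 < t by near: t; exact: nbhs_right_gt.
have Ut : U (x_ t) by near: t.
have := zP _ Ut _ Ux; have := vxi _ Ut.
have := value_le Y0 Yc YO oO lev gL Ux (yP _ Ut).1.
rewrite /v (min_valueE (yP _ Ut)).
have -> : xbar - x_ t = t *: d by rewrite /x_ subKr.
have -> : x_ t - xbar = - (t *: d) by rewrite /x_ addrAC subrr add0r.
rewrite dotNr !dotZr sqnormN sqnormZ => h1 h2 h3.
rewrite -(ler_pM2l t0); nra.
Unshelve. all: by end_near. Qed.

(** This is [argmin_superdiff_cvg] with constant base point [xbar] and the identity as family of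
    supergradients: the limit is a cluster point of the given filter. *)
Lemma compact_argmin_superdiff : compact C.
Proof.
move=> F FF FC.
have /choice[y_ yP] z : exists y, C z ->
    argmin Y (g xbar) y /\ superdiff rho U (g^~ y) xbar z.
  have [[y ? ?]|nC] := pselect (C z); last by exists 0.
  by exists y.
have [||||G [GF FG] [z Cz Gz]] :=
    @argmin_superdiff_cvg _ F FF (fun=> xbar) y_ id (L + rho * (r / 2)).
- exact: cvg_cst.
- by apply: filterS FC => z /yP[].
- by apply: filterS FC => z /yP[].
- apply: filterS FC => z /yP[[Yy _] yz]; apply: argmin_superdiff_bounded yz.
    by apply: ballxx; rewrite divr_gt0.
  exact: YO.
exists z; split => // A B FA zB.
exact: (filter_ex (filterI (FG _ FA) (Gz _ zB))).
Qed.

Lemma superdiff_value : superdiff rho U v xbar = convex_hull C.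
Proof.
apply/seteqP; split => [xi vxi|]; last first.
  apply: convex_hull_min.
    by apply/convex_setP => a b t va vb t01; exact: superdiff_convex.
  move=> z [y yP yz] x Ux'; rewrite {2}/v (min_valueE yP).
  exact: le_trans (value_le Y0 Yc YO oO lev gL Ux' yP.1) (yz x Ux').
(* Direction 0 is used only to see that [C] is nonempty. *)
have [c Cc _] := superdiff_value_dir 0 vxi.
have [|||p /set_mem Kp pmin] :=
    @EVT_min_rV R n (fun x => sqnorm (x - xi)) (convex_hull C).
- by exists c; exact: sub_convex_hull.
- exact/compact_convex_hull/compact_argmin_superdiff.
- by apply: continuous_subspaceT => x; exact: continuous_sqnorm_subr.
suff -> : xi = p by [].
have [z Cz zd] := superdiff_value_dir (xi - p) vxi.
(* Minimality of the distance at [p], tested along the segment from [p] to [z]. *)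
have key t : 0 <= t <= 1 ->
    0 <= t * (2 * dot (z - p) (p - xi)) + t ^+ 2 * sqnorm (z - p).
  move=> t01; have /pmin : t *: z + (1 - t) *: p \in convex_hull C.
    apply/mem_set; move/convex_setP: (@convex_convex_hull _ _ C); apply => //.
    exact: sub_convex_hull.
  have -> : t *: z + (1 - t) *: p - xi = (p - xi) + t *: (z - p).
    by apply/rowP => i; rewrite !mxE; ring.
  by rewrite (sqnormD (p - xi)) sqnormZ dotZr (dotC (p - xi)); lra.
have : dot (z - p) (p - xi) <= - sqnorm (xi - p).
  move: zd; rewrite -(opprB xi p) dotNr /sqnorm.
  by rewrite (dotDl z) (dotDl xi) !dotNl; lra.
set b := dot _ _ in key *; set D := sqnorm (xi - p) => bD.
suff D0 : D <= 0.
  by apply/eqP; rewrite -subr_eq0; apply/eqP/sqnorm_eq0/le_anti; rewrite D0 sqnorm_ge0.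
rewrite leNgt; apply/negP => D0; have := sqnorm_ge0 (z - p).
set Q := sqnorm (z - p) in key * => Q0; have QD : 0 < Q + D by lra.
(* With this t one has 0 < t <= 1 and t Q <= D, so 2 t b + t^2 Q <= -2 t D + t D < 0, against [key].
   The denominator Q + D is positive even when Q = 0. *)
pose t := D / (Q + D); have t0 : 0 < t by rewrite divr_gt0.
have t1 : t <= 1 by rewrite ler_pdivrMr//; lra.
have tQ : t * Q <= D.
  by rewrite /t mulrAC ler_pdivrMr//; nra.
by have := key t; rewrite (ltW t0) t1 => /(_ isT); rewrite leNgt => /negP; apply; nra.
Qed.

End Danskin.

(** * Passage to Clarke gradients and the theorem *)

Lemma lipschitz_onP {R : realType} {V W : normedModType R} (f : V -> W) (A : set V) :
  [lipschitz f x | x in A] ->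
  exists2 L : R, 0 <= L & forall x y, A x -> A y -> `|f x - f y| <= L * `|x - y|.
Proof.
move=> [M [_ MP]]; exists (`|M| + 1); first by rewrite addr_ge0.
move=> x y Ax Ay; apply: (MP _ _ (x, y)); last by split.
by rewrite (le_lt_trans (ler_norm _))// ltrDl.
Qed.

Lemma rho_weakly_concave_sub {R : realType} {n : nat} (rho : R)
    (A B : set 'rV[R]_n) (f : 'rV[R]_n -> R) :
  A `<=` B -> rho_weakly_concave rho B f -> rho_weakly_concave rho A f.
Proof.
move=> AB fB t x y /set_mem Ax /set_mem Ay; apply: fB; apply/mem_set; exact: AB.
Qed.

Lemma clarke_gradient_superdiff {R : realType} {n : nat} (rho L : R)
    (U : set 'rV[R]_n) (f : 'rV[R]_n -> R) x0 : open U -> U x0 ->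
  (forall x y, U x -> U y -> `|f x - f y| <= L * `|x - y|) ->
  rho_weakly_concave rho U f -> clarke_gradient f x0 = superdiff rho U f x0.
Proof.
move=> oU Ux0 fL wf; apply/seteqP; split.
  apply: clarke_superdiff => // x Ux; apply: lipschitz_continuous_for fL.
  exact: open_nbhs_nbhs.
by apply: superdiff_clarke; exact: open_nbhs_nbhs.
Qed.

Unset Implicit Arguments.

Theorem theorem3p11 (R : realType) (n m : nat)
    (Y : set 'rV[R]_m) (xbar : 'rV[R]_n)
    (Om : set 'rV[R]_n) (OY : set 'rV[R]_m)
    (g : 'rV[R]_n -> 'rV[R]_m -> R) (rho : R)
    (Y_nonempty : Y !=set0) (Y_closed : closed Y)
    (Om_convex : @convex_set R 'rV[R]_n Om) (Om_nbhs : nbhs xbar Om)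
    (OY_open : open OY) (Y_sub_OY : Y `<=` OY)
    (g_level_bounded : level_bounded_locally_uniformly Y g)
    (g_lipschitz : [lipschitz (g p.1 p.2 : R^o) | p in Om `*` OY])
    (rho_gt0 : 0 < rho)
    (g_weakly_concave :
       forall y, OY y -> rho_weakly_concave rho Om (fun x => g x y)) :
  let v := fun x => min_value Y (g x) in
  let S := fun x => argmin Y (g x) in
  [/\ forall x, Om x -> exists2 y, S x y & v x = g x y,
      weakly_concave Om v
    & clarke_gradient v xbar =
      convex_hull [set xi | exists2 ybar, S xbar ybar &
                     clarke_gradient (fun x => g x ybar) xbar xi]].
Proof.
move=> v S; have [L L0 gL] := lipschitz_onP g_lipschitz.
(* [Om] need not be open: gradients are computed on an open ball inside it, whereas attainment and
   weak concavity are proved on all of [Om]. *)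
have /nbhs_ballP[r /= r0 rOm] := Om_nbhs; pose U := ball xbar r.
have oU : open U by exact: ball_open.
have rU : ball xbar r `<=` U by [].
have Ux : U xbar by exact: ballxx.
have gLU p q : (U `*` OY) p -> (U `*` OY) q -> `|g p.1 p.2 - g q.1 q.2| <= L * `|p - q|.
  by move=> [Up Op] [Uq Oq]; apply: gL; split => //; exact: rOm.
have S_nonempty x : Om x -> exists y, S x y.
  exact: (argmin_nonempty Y_nonempty Y_closed Y_sub_OY OY_open g_level_bounded gL).
have v_concave : rho_weakly_concave rho Om v.
  exact: (value_weakly_concave Y_nonempty Y_closed Y_sub_OY OY_open g_level_bounded gL).
have g_concave y : OY y -> rho_weakly_concave rho U (g^~ y).
  by move=> Oy; apply: rho_weakly_concave_sub (g_weakly_concave y Oy).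
split.
- by move=> x /S_nonempty[y yP]; exists y => //; exact: min_valueE.
- by exists rho.
have gE y : S xbar y ->
    clarke_gradient (fun x => g x y) xbar = superdiff rho U (g^~ y) xbar.
  move=> /proj1/Y_sub_OY Oy; apply: (clarke_gradient_superdiff (L := L)) => //.
    by move=> x x' Ux1 Ux2; exact: (lipschitz_fst gLU).
  exact: g_concave.
have -> : clarke_gradient v xbar = superdiff rho U v xbar.
  apply: (clarke_gradient_superdiff (L := L)) => //.
    move=> x x' Ux1 Ux2.
    exact: (value_lipschitz Y_nonempty Y_closed Y_sub_OY OY_open g_level_bounded gLU).
  exact: rho_weakly_concave_sub v_concave.
rewrite [LHS](superdiff_value Y_nonempty Y_closed Y_sub_OY OY_open oU r0
  rU L0 (ltW rho_gt0) g_level_bounded gLU g_concave).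
congr convex_hull; apply/seteqP.
by split => z [y yP zP]; exists y; rewrite // ?gE// -gE.
Qed.
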